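(* Let $G=(V,E)$ be a graph with $V=\{1,\dots,n\}$, let $\Sigma\subseteq\mathrm{Aut}(G)$, and let $v\in\mathcal{R}_d(G,\Sigma)$ be an irreducible $\Sigma$-realization. Then $v$ can be deformed (within $\mathcal{R}_d(G,\Sigma)$) into a balanced $\Sigma$-realization. Moreover, if $v$ is not already balanced, then $v$ can be deformed into at least two balanced $\Sigma$-realizations $w$ and $w'$ which are balanced with respect to different eigenvalues of $G$.
   Context: $G$ is a finite simple undirected graph with adjacency matrix $A$; $N(i)$ is the neighbourhood of $i$. A $d$-dimensional realization is a map $v\colon V\to\mathbb{R}^d$, $i\mapsto v_i$; it is full-dimensional if the $v_i$ span $\mathbb{R}^d$. It is a $\Sigma$-realization if there is a group homomorphism $T\colon\Sigma\to\mathrm{O}(\mathbb{R}^d)$ with $T_\sigma v_i=v_{\sigma(i)}$ for all $i\in V,\sigma\in\Sigma$; it is irreducible if $T$ has no invariant subspaces other than $\{0\}$ and $\mathbb{R}^d$. It is balanced (with eigenvalue $\theta$) if $\sum_{j\in N(i)}v_j=\theta v_i$ for all $i\in V$. $\mathcal{R}_d(G,\Sigma)$ is the set of full-dimensional $d$-dimensional $\Sigma$-realizations, viewed as a subset of $\mathbb{R}^{n\times d}$ (the realization identified with the matrix with rows $v_i^\top$) with the subspace topology. $v$ can be deformed into $w$ if there is a continuous curve $\gamma\colon[0,1]\to\mathcal{R}_d(G,\Sigma)$ with $\gamma(0)=v$, $\gamma(1)=w$. *)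

(* Defs.v *)
From mathcomp Require Import all_boot all_order all_algebra all_fingroup.
From mathcomp Require Import mxrepresentation.
From mathcomp Require Import all_classical all_reals all_analysis.

Set Implicit Arguments.
Unset Strict Implicit.
Unset Printing Implicit Defensive.

Import Order.TTheory GRing.Theory Num.Theory numFieldNormedType.Exports.
Local Open Scope classical_set_scope.
Local Open Scope ring_scope.

Section SimpleGraph.
Variables (n : nat) (e : rel 'I_n).

Definition simple_graph : Prop := symmetric e /\ irreflexive e.

Definition graph_aut : {set 'S_n} :=
  [set s : 'S_n | [forall i, forall j, e (s i) (s j) == e i j]]%SET.

Definition adjacency (R : realType) : 'M[R]_n := \matrix_(i, j) (e i j)%:R.

End SimpleGraph.

(* A realization i |-> v_i in R^d is the matrix whose i-th row is v_i^T.      *)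
(* Vectors being rows, T_sigma is encoded by its transpose rT sigma acting on *)
(* the right.  As (s * t) i = t (s i) in 'S_n, T is a homomorphism for        *)
(* composition of maps exactly when rT (s * t) = rT s *m rT t, which is what  *)
(* [mx_representation] requires.                                              *)
Section Realizations.
Variables (R : realType) (n d : nat) (Sigma : {group 'S_n}).
Implicit Types (v w : 'M[R]_(n, d)) (rT : mx_representation R Sigma d).

Definition orthogonal_repr rT : Prop :=
  forall s, s \in Sigma -> rT s *m (rT s)^T = 1%:M.

Definition realizes rT v : Prop :=
  orthogonal_repr rT /\
  forall s i, s \in Sigma -> row i v *m rT s = row (s i) v.

Definition sigma_realization v : Prop := exists rT, realizes rT v.

(* Subspaces of R^d are row spaces of d x d matrices.  Unlike the library's   *)
(* [mx_irreducible], this does not exclude d = 0.                             *)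
Definition irreducible_repr rT : Prop :=
  forall U : 'M[R]_d, mxmodule rT U -> U = 0 \/ row_full U.

Definition irreducible_realization v : Prop :=
  exists rT, realizes rT v /\ irreducible_repr rT.

Definition realization_space : set 'M[R]_(n, d) :=
  [set v | row_full v /\ sigma_realization v].

Definition deformable v w : Prop :=
  exists gamma : R -> 'M[R]_(n, d),
    [/\ {within `[0, 1], continuous gamma},
        forall t : R, t \in `[0, 1] -> realization_space (gamma t),
        gamma 0 = v & gamma 1 = w].

End Realizations.

Section Balanced.
Variables (R : realType) (n d : nat) (e : rel 'I_n).
Implicit Types v : 'M[R]_(n, d).

Definition balanced_with (theta : R) v : Prop :=
  forall i, \sum_(j | e i j) row j v = theta *: row i v.

Definition balanced v : Prop := exists theta, balanced_with theta v.

End Balanced.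

(* Main.v *)
Require Import Defs.
From mathcomp Require Import all_boot all_order all_algebra all_fingroup.
From mathcomp Require Import mxrepresentation.
From mathcomp Require Import all_classical all_reals all_analysis.
From mathcomp Require Import ring lra.

Set Implicit Arguments.
Unset Strict Implicit.
Unset Printing Implicit Defensive.

Import Order.TTheory GRing.Theory Num.Theory numFieldNormedType.Exports.
Local Open Scope ring_scope.

(** Fix the representation [rT] of the irreducible realization [v]. The
    matrices equivariant for [rT] form a linear space that is stable under the
    adjacency matrix [A] and contains [v]; by irreducibility every nonzero
    member is full-dimensional. The maximum and the minimum of the Rayleigh
    quotient of [A] on this space are attained at eigenvectors, that is, at
    balanced realizations. If the two extremal values agree then [A] is a scalar
    on the whole space and [v] is balanced. Otherwise the segment from [v]
    to an extremal eigenvector avoids [0], as [v] is not a multiple of it, so it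
    is a deformation. *)

(** * Continuity and compactness for real matrices *)

Section MatrixTopology.
Local Open Scope classical_set_scope.
Variable R : realType.

Lemma continuous_mx (T : topologicalType) m n (F : T -> 'M[R]_(m, n)) :
  (forall i j, continuous (fun x => F x i j)) -> continuous F.
Proof.
move=> cF x A [P nP PA].
have nQ : nbhs x [set y | forall i j, P i j (F y i j)].
  by do 2 (apply: filter_forall => ?); exact/cF/nP.
by apply: filterS nQ => y Py; apply: PA.
Qed.

Lemma continuous_mulmx (T : topologicalType) m n p
    (F : T -> 'M[R]_(m, n)) (G : T -> 'M[R]_(n, p)) :
  continuous F -> continuous G -> continuous (fun x => F x *m G x).
Proof.
move=> cF cG; apply: continuous_mx => i j.
rewrite (_ : (fun _ => _) = fun x => \sum_k F x i k * G x k j); last first.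
  by apply/funext => x; rewrite mxE.
apply: continuous_big; first exact: add_continuous.
move=> k _ x; apply: cvgM.
- apply: (@continuous_comp _ _ _ F (fun M => M i k)); first exact: cF.
  exact: coord_continuous.
- apply: (@continuous_comp _ _ _ G (fun M => M k j)); first exact: cG.
  exact: coord_continuous.
Qed.

Lemma continuous_trmx m n : continuous (trmx : 'M[R]_(m, n) -> 'M[R]_(n, m)).
Proof.
apply: continuous_mx => i j; under eq_fun do rewrite mxE.
exact: coord_continuous.
Qed.

Lemma continuous_mxtrace n : continuous (mxtrace : 'M[R]_n -> R).
Proof.
apply: continuous_big; first exact: add_continuous.
by move=> k _; exact: coord_continuous.
Qed.

(** Heine-Borel by transport: [vec_mx] is continuous and onto, so [A] is the image of its preimage,
    a closed subset of the compact box of row vectors with entries in $[-b, b]$. *)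
Lemma compact_mx (b : R) m n (A : set 'M[R]_(m, n)) :
  closed A -> (forall X, A X -> forall i j, `|X i j| <= b) -> compact A.
Proof.
move=> cA bA.
have cV : continuous (@vec_mx R m n).
  apply: continuous_mx => i j; under eq_fun do rewrite mxE.
  exact: coord_continuous.
rewrite (_ : A = vec_mx @` (vec_mx @^-1` A)); last first.
  apply/seteqP; split => [X AX|_ [u ? <-]//].
  by exists (mxvec X); rewrite /= ?mxvecK.
apply: continuous_compact; first exact: continuous_subspaceT.
have box := @rV_compact R (m * n) (fun=> `[(- b), b])
  (fun=> @segment_compact R _ _).
apply: subclosed_compact box _; first exact: preimage_closed.
move=> u /bA bu k; case/mxvec_indexP: k => i j.
by have := bu i j; rewrite mxE ler_norml /= in_itv.
Qed.

End MatrixTopology.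

(** * Extremal eigenvectors of a symmetric matrix on an invariant linear space *)

Section RayleighQuotient.
Local Open Scope classical_set_scope.
Variables (R : realType) (n d : nat).
Implicit Types (X Y : 'M[R]_(n, d)) (A B : 'M[R]_n).

(** The Frobenius inner product, for which left multiplication by a symmetric matrix is
    self-adjoint. *)
Definition frob X Y : R := \tr (X *m Y^T).

Lemma frobE X Y : frob X Y = \sum_i \sum_j X i j * Y i j.
Proof.
by apply: eq_bigr => i _; rewrite mxE; apply: eq_bigr => j _; rewrite mxE.
Qed.

Lemma frobC X Y : frob X Y = frob Y X.
Proof. by rewrite /frob -mxtrace_tr trmx_mul trmxK. Qed.

Lemma frobDl X Y Z : frob (X + Y) Z = frob X Z + frob Y Z.
Proof. by rewrite /frob mulmxDl mxtraceD. Qed.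

Lemma frobZl a X Y : frob (a *: X) Y = a * frob X Y.
Proof. by rewrite /frob -scalemxAl mxtraceZ. Qed.

Lemma frobDr X Y Z : frob Z (X + Y) = frob Z X + frob Z Y.
Proof. by rewrite frobC frobDl !(frobC _ Z). Qed.

Lemma frobZr a X Y : frob X (a *: Y) = a * frob X Y.
Proof. by rewrite frobC frobZl frobC. Qed.

Lemma frob_sym A X Y : A^T = A -> frob (A *m X) Y = frob X (A *m Y).
Proof. by move=> sA; rewrite /frob trmx_mul sA -mulmxA mxtrace_mulC mulmxA. Qed.

Lemma frob_ge0 X : 0 <= frob X X.
Proof. by rewrite frobE; do 2 (apply: sumr_ge0 => ? _); rewrite -expr2 sqr_ge0. Qed.

Lemma sqr_coef_le_frob X i j : X i j ^+ 2 <= frob X X.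
Proof.
rewrite frobE (bigD1 i) //= (bigD1 j) //= -addrA expr2 lerDl.
apply: addr_ge0; first by apply: sumr_ge0 => ? _; rewrite -expr2 sqr_ge0.
by do 2 (apply: sumr_ge0 => ? _); rewrite -expr2 sqr_ge0.
Qed.

Lemma frob_eq0 X : (frob X X == 0) = (X == 0).
Proof.
apply/eqP/eqP => [X0|->]; last by rewrite /frob mul0mx mxtrace0.
apply/matrixP => i j; rewrite mxE; apply/eqP; rewrite -sqrf_eq0 eq_le sqr_ge0 andbT.
by rewrite -X0 sqr_coef_le_frob.
Qed.

Lemma frob_gt0 X : (0 < frob X X) = (X != 0).
Proof. by rewrite lt_def frob_ge0 andbT frob_eq0. Qed.

Lemma continuous_quadratic A : continuous (fun X => frob (A *m X) X).
Proof.
move=> X.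
apply: (@continuous_comp _ _ _ (fun Y => A *m Y *m Y^T) (@mxtrace R n)).
2: exact: continuous_mxtrace.
move: X; apply: continuous_mulmx; last exact: continuous_trmx.
by apply: continuous_mulmx; [exact: cst_continuous|move=> ?; exact: cvg_id].
Qed.

Variable W : set 'M[R]_(n, d).
Hypothesis W_closed : closed W.
Hypothesis W_linear : forall a X Y, W X -> W Y -> W (a *: X + Y).

Let W_scale a X : W X -> W (a *: X).
Proof.
(* Writing $aX = (a-1)X + X$ avoids having to know that $0$ lies in [W]. *)
move=> WX; rewrite -[a](subrK 1) scalerDl scale1r; exact: W_linear.
Qed.

(* The polynomial [t |-> frob (B (X + t B X)) (X + t B X)] is nonnegative and
   vanishes at [0], so its derivative there, [2 |B X|^2], is [0]. *)
Lemma psd_isotropic B X :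
  B^T = B -> (forall Y, W Y -> W (B *m Y)) ->
  (forall Y, W Y -> 0 <= frob (B *m Y) Y) ->
  W X -> frob (B *m X) X = 0 -> B *m X = 0.
Proof.
move=> sB BW B_ge0 WX qX0; set Y := B *m X.
have WY : W Y by exact: BW.
apply/eqP; rewrite -frob_eq0; apply/eqP.
set c := frob Y Y; set q := frob (B *m Y) Y.
have c_ge0 : 0 <= c by exact: frob_ge0.
have q_ge0 : 0 <= q by exact: B_ge0.
have key t : 0 <= t * (c *+ 2 + t * q).
  have := B_ge0 _ (W_linear t WY WX).
  rewrite mulmxDr -scalemxAr !(frobDl, frobDr, frobZl, frobZr) qX0.
  rewrite (frob_sym Y X sB) -/Y -/q -/c => h; lra.
(* A negative [t] small enough for the linear term to dominate; the [+ 1] keeps the denominator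
   positive when [q] is $0$. *)
have := key (- (c / (q + 1))).
have q1 : 0 < q + 1 by rewrite ltr_wpDl.
have -> : - (c / (q + 1)) * (c *+ 2 + - (c / (q + 1)) * q) =
          - (c ^+ 2 * (q + 2) / (q + 1) ^+ 2) by field; rewrite gt_eqF.
rewrite oppr_ge0 => h.
have : c ^+ 2 * (q + 2) <= 0.
  by move: h; rewrite pmulr_lle0 // invr_gt0 exprn_gt0.
rewrite pmulr_lle0 ?ltr_wpDl //.
by move=> h2; apply/eqP; rewrite -sqrf_eq0 eq_le h2 sqr_ge0.
Qed.

(** The quadratic form of [A] attains its maximum [mu] on the compact unit sphere of [W]. By
    homogeneity [mu%:M - A] is positive semidefinite on [W], and it is isotropic at the maximizer,
    hence kills it. *)
Lemma rayleigh_max A X0 :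
  A^T = A -> (forall X, W X -> W (A *m X)) -> W X0 -> X0 != 0 ->
  exists X mu, [/\ W X, X != 0, A *m X = mu *: X &
    forall Y, W Y -> frob (A *m Y) Y <= mu * frob Y Y].
Proof.
move=> sA AW WX0 X0_neq0.
pose K := W `&` [set X | frob X X = 1].
have normal X : W X -> X != 0 -> K ((Num.sqrt (frob X X))^-1 *: X).
  move=> WX; rewrite -frob_gt0 => X_gt0; split; first exact: W_scale.
  rewrite /= frobZl frobZr mulrA -invfM -expr2 sqr_sqrtr ?frob_ge0 //.
  by rewrite mulVf // gt_eqF.
have cK : compact K.
  apply: (@compact_mx _ 1) => [|X [_ /= X1] i j].
    apply: closedI => //; have sq_closed := continuous_closedP (fun X => frob X X).
    apply: sq_closed.1 [set 1] _; last exact: closed_eq.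
    (* The squared norm is the quadratic form of the identity. *)
    have := @continuous_quadratic 1%:M.
    by under eq_fun do rewrite mul1mx.
  have := sqr_coef_le_frob X i j.
  by rewrite X1 -real_normK ?num_real // expr_le1.
have [|||X /set_mem[WX /= X1] Xmax] := @compact_EVT_max _ _ (fun X => frob (A *m X) X) K.
- by eexists; exact: normal WX0 X0_neq0.
- by [].
- exact/continuous_subspaceT/continuous_quadratic.
set mu := frob (A *m X) X in Xmax.
have mu_ub Y : W Y -> frob (A *m Y) Y <= mu * frob Y Y.
  move=> WY; have [->|Y_neq0] := eqVneq Y 0.
    by rewrite mulmx0 /frob mul0mx mxtrace0 mulr0.
  have Y_gt0 : 0 < frob Y Y by rewrite frob_gt0.
  have := Xmax _ (mem_set (normal Y WY Y_neq0)).
  rewrite -scalemxAr frobZl frobZr mulrA -invfM -expr2 sqr_sqrtr ?frob_ge0 //.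
  by rewrite mulrC ler_pdivrMr.
exists X, mu; split => //.
  by rewrite -frob_gt0 X1.
pose B := mu%:M - A.
have BE Y : B *m Y = (-1) *: (A *m Y) + mu *: Y.
  by rewrite mulmxBl mul_scalar_mx scaleN1r addrC.
suff: B *m X = 0.
  by rewrite BE scaleN1r addrC => /eqP; rewrite subr_eq0 => /eqP.
apply: psd_isotropic WX _.
- by rewrite linearB /= tr_scalar_mx sA.
- move=> Y WY; rewrite BE; apply: W_linear; [exact: AW | exact: W_scale].
- move=> Y WY; rewrite BE frobDl !frobZl; have := mu_ub _ WY; lra.
- rewrite BE frobDl !frobZl X1 -/mu; lra.
Qed.

(** The maximum for [- A] is minus the minimum for [A]. If both extrema of [A] were [mu], the form
    of [mu%:M - A] would vanish on [W], and [psd_isotropic] would make [X0] an eigenvector. *)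
Lemma two_eigenvalues A X0 :
  A^T = A -> (forall X, W X -> W (A *m X)) -> W X0 ->
  (forall mu, A *m X0 <> mu *: X0) ->
  exists X Y mu nu, [/\ W X /\ W Y, X != 0 /\ Y != 0,
    A *m X = mu *: X, A *m Y = nu *: Y & mu <> nu].
Proof.
move=> sA AW WX0 X0_not_eigen.
have X0_neq0 : X0 != 0.
  by apply/eqP => X00; apply: (X0_not_eigen 0); rewrite X00 mulmx0 scaler0.
have [X [mu [WX X_neq0 AX mu_ub]]] := rayleigh_max sA AW WX0 X0_neq0.
have sNA : (- A)^T = - A by rewrite linearN /= sA.
have NAW Z : W Z -> W (- A *m Z).
  by move=> WZ; rewrite mulNmx -scaleN1r; apply/W_scale/AW.
have [Y [nu [WY Y_neq0 AY nu_ub]]] := rayleigh_max sNA NAW WX0 X0_neq0.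
exists X, Y, mu, (- nu); split => //.
  by rewrite scaleNr -AY mulNmx opprK.
move=> mu_nu; apply: (X0_not_eigen mu).
pose B := mu%:M - A.
have BE Z : B *m Z = (-1) *: (A *m Z) + mu *: Z.
  by rewrite mulmxBl mul_scalar_mx scaleN1r addrC.
have B0 Z : W Z -> frob (B *m Z) Z = 0.
  move=> WZ; have := nu_ub _ WZ; have := mu_ub _ WZ.
  rewrite BE frobDl !frobZl mulNmx -scaleN1r frobZl mu_nu; lra.
suff: B *m X0 = 0.
  by rewrite BE scaleN1r addrC => /eqP; rewrite subr_eq0 => /eqP.
apply: psd_isotropic (B0 _ WX0) => //.
- by rewrite linearB /= tr_scalar_mx sA.
- move=> Z WZ; rewrite BE; apply: W_linear; [exact: AW | exact: W_scale].
- by move=> Z WZ; rewrite B0.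
Qed.

End RayleighQuotient.

(** * The adjacency matrix, automorphisms and balancedness *)

Section Adjacency.
Variables (R : realType) (n d : nat) (e : rel 'I_n).
Implicit Types w : 'M[R]_(n, d).
Let A := adjacency e R.

Lemma adjacency_tr : symmetric e -> A^T = A.
Proof. by move=> sym_e; apply/matrixP => i j; rewrite !mxE sym_e. Qed.

Lemma perm_mx_adjacency s : s \in graph_aut e ->
  perm_mx s *m A = A *m perm_mx s.
Proof.
rewrite inE => /forallP aut_s; rewrite -row_permE -[s in RHS]invgK -col_permE.
apply/matrixP => i j; rewrite !mxE; congr (_%:R : R); congr nat_of_bool.
(* The entries to compare are [e (s i) j] and [e i (s^-1 j)]: invariance of [e] at the pair of [i]
   and [s^-1 j]. *)
by have /forallP/(_ (s^-1 j)%g)/eqP := aut_s i; rewrite permKV.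
Qed.

Lemma balanced_withP theta w :
  balanced_with e theta w <-> A *m w = theta *: w.
Proof.
have rowA i : \sum_(j | e i j) row j w = row i (A *m w).
  rewrite row_mul mulmx_sum_row big_mkcond /=; apply: eq_bigr => j _.
  by rewrite !mxE; case: (e i j); rewrite ?scale1r ?scale0r.
split => [bal_w|Aw i]; last by rewrite rowA Aw linearZ.
by apply/row_matrixP => i; rewrite -rowA bal_w linearZ.
Qed.

(** Any nonzero column of [w] is an eigenvector; since [eigenvalue] refers to row vectors, it is
    transposed, using the symmetry of [A]. *)
Lemma adjacency_eigenvalue theta w : symmetric e -> w != 0 ->
  A *m w = theta *: w -> eigenvalue A theta.
Proof.
move=> sym_e w_neq0 Aw.
have wA : w^T *m A = theta *: w^T.
  by rewrite -{1}(adjacency_tr sym_e) -trmx_mul Aw linearZ.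
have [j wj_neq0] : exists j, row j w^T != 0.
  apply/existsP; apply: contra_neqT w_neq0 => /existsPn w0.
  apply: trmx_inj; apply/row_matrixP => j.
  by rewrite trmx0 row0; apply/eqP; have := w0 j; rewrite negbK.
by apply/eigenvalueP; exists (row j w^T) => //; rewrite -row_mul wA linearZ.
Qed.

End Adjacency.

(** * Equivariant matrices and segments between them *)

Section Equivariant.
Local Open Scope classical_set_scope.
Variables (R : realType) (n d : nat) (Sigma : {group 'S_n}).
Variable rT : mx_representation R Sigma d.
Implicit Types v w : 'M[R]_(n, d).

(** The intertwiners between [rT] and the permutation action on $\mathbb{R}^n$. Leaving
    orthogonality out, as it concerns [rT] alone, makes this a linear condition on [w]. *)
Definition equivariant : set 'M[R]_(n, d) :=
  [set w | forall s, s \in Sigma -> perm_mx s *m w = w *m rT s].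

Lemma realizesP w :
  realizes rT w <-> orthogonal_repr rT /\ equivariant w.
Proof.
have rowE s i : row i (perm_mx s *m w) = row (s i) w.
  by rewrite -row_permE; apply/rowP => j; rewrite !mxE.
split => -[orth eq_w]; split => // s.
  by move=> Ss; apply/row_matrixP => i; rewrite rowE row_mul eq_w.
by move=> i Ss; rewrite -rowE eq_w // row_mul.
Qed.

Lemma equivariant_linear a v w :
  equivariant v -> equivariant w -> equivariant (a *: v + w).
Proof.
move=> eq_v eq_w s Ss.
by rewrite mulmxDr mulmxDl -scalemxAr -scalemxAl eq_v // eq_w.
Qed.

Lemma closed_equivariant : closed equivariant.
Proof.
have -> : equivariant = \bigcap_(s in [set` Sigma])
    ((fun w => perm_mx s *m w - w *m rT s) @^-1` [set 0]).
  apply/seteqP; split => w eq_w s /= Ss; first by rewrite eq_w // subrr.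
  by have /eqP := eq_w s Ss; rewrite subr_eq0 => /eqP.
have cid : continuous (fun w : 'M[R]_(n, d) => w) by move=> w; exact: cvg_id.
apply: closed_bigI => s _; apply: (continuous_closedP _).1.
  have cL : continuous (fun w : 'M[R]_(n, d) => perm_mx s *m w).
    by apply: continuous_mulmx => //; exact: cst_continuous.
  have cR : continuous (fun w : 'M[R]_(n, d) => w *m rT s).
    by apply: continuous_mulmx => //; exact: cst_continuous.
  by move=> w; exact: (continuousB (cL w) (cR w)).
apply: accessible_closed_set1; apply: hausdorff_accessible.
exact: (@norm_hausdorff R 'M[R]_(n, d)).
Qed.

Lemma equivariant_adjacency e w : Sigma \subset graph_aut e ->
  equivariant w -> equivariant (adjacency e R *m w).
Proof.
move=> aut eq_w s Ss; rewrite mulmxA perm_mx_adjacency ?(fintype.subsetP aut) //.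
by rewrite -!mulmxA eq_w.
Qed.

(** As in Schur's lemma: [w *m rT s] only permutes the rows of [w], so the row space is a nonzero
    submodule, hence everything. The square matrix [<<w>>] represents it. *)
Lemma equivariant_row_full w : irreducible_repr rT ->
  equivariant w -> w != 0 -> row_full w.
Proof.
move=> irr eq_w w_neq0; have [|w0|] := irr <<w>>%MS.
- apply/mxmoduleP => s Ss; rewrite (eqmxMr _ (genmxE w)) genmxE -eq_w //.
  exact: submxMl.
- by case/eqP: w_neq0; apply/eqP; rewrite -submx0 -(genmxE w) w0 sub0mx.
- by rewrite /row_full genmxE.
Qed.

(** Every point of the segment is equivariant, so it only has to be nonzero: at $t = 1$ it is [w],
    and for $t \neq 1$ a zero would make [v] a multiple of [w]. *)
Lemma segment_deformable v w :
  orthogonal_repr rT -> irreducible_repr rT ->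
  equivariant v -> equivariant w -> w != 0 -> (forall c, v <> c *: w) ->
  deformable Sigma v w.
Proof.
move=> orth irr eq_v eq_w w_neq0 indep.
exists (fun t => (1 - t) *: v + t *: w); split.
- apply: continuous_subspaceT => t; apply: cvgD; apply: cvgZ.
  + by apply: cvgB; [exact: cvg_cst|exact: cvg_id].
  + exact: cvg_cst.
  + exact: cvg_id.
  + exact: cvg_cst.
- move=> t _; set u := _ + _.
  have eq_u : equivariant u.
    apply: equivariant_linear => //; rewrite -[t](subrK 1) scalerDl scale1r.
    exact: equivariant_linear.
  split; last by exists rT; apply/realizesP.
  apply: equivariant_row_full => //; apply/eqP => /eqP u0.
  have [t1|t_neq1] := eqVneq t 1.
    by move: u0; rewrite /u t1 subrr scale0r add0r scale1r (negPf w_neq0).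
  have t1 : 1 - t != 0 by rewrite subr_eq0 eq_sym.
  apply: (indep (- ((1 - t)^-1 * t))); apply: (scalerI t1).
  rewrite scalerA mulrN mulrA divff // mul1r scaleNr.
  by apply/eqP; rewrite -addr_eq0.
- by rewrite subr0 scale1r scale0r addr0.
- by rewrite subrr scale0r add0r scale1r.
Qed.

End Equivariant.

Theorem theorem2p20 (R : realType) (n d : nat) (e : rel 'I_n)
    (Sigma : {group 'S_n}) (v : 'M[R]_(n, d)) :
  simple_graph e ->
  Sigma \subset graph_aut e ->
  realization_space Sigma v ->
  irreducible_realization Sigma v ->
  (exists w : 'M[R]_(n, d), deformable Sigma v w /\ balanced e w) /\
  (~ balanced e v ->
   exists (w w' : 'M[R]_(n, d)) (theta theta' : R),
     [/\ deformable Sigma v w /\ deformable Sigma v w',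
         balanced_with e theta w,
         balanced_with e theta' w',
         eigenvalue (adjacency e R) theta /\ eigenvalue (adjacency e R) theta' &
         theta <> theta']).
Proof.
move=> [sym_e _] aut vR [rT [/realizesP[orth eq_v] irr]].
have not_balanced : ~ balanced e v ->
   exists (w w' : 'M[R]_(n, d)) (theta theta' : R),
     [/\ deformable Sigma v w /\ deformable Sigma v w',
         balanced_with e theta w,
         balanced_with e theta' w',
         eigenvalue (adjacency e R) theta /\ eigenvalue (adjacency e R) theta' &
         theta <> theta'].
  move=> not_bal.
  have not_eigen mu : adjacency e R *m v <> mu *: v.
    by move=> Av; apply: not_bal; exists mu; apply/balanced_withP.
  have [w [w' [theta [theta' [[eq_w eq_w'] [w0 w'0] Aw Aw' neq]]]]] :=
    two_eigenvalues (closed_equivariant (rT := rT))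
      (@equivariant_linear _ _ _ _ rT)
      (adjacency_tr R sym_e) (fun X => @equivariant_adjacency _ _ _ _ rT e X aut)
      eq_v not_eigen.
  (* A multiple of an eigenvector satisfies the same eigenvalue equation, which [v] does not. *)
  have indep u mu : adjacency e R *m u = mu *: u -> forall c, v <> c *: u.
    move=> Au c vE; apply: (not_eigen mu).
    by rewrite vE -scalemxAr Au !scalerA mulrC.
  exists w, w', theta, theta'; split => //.
  - split; apply: segment_deformable orth irr eq_v _ _ _ => //.
      exact: indep Aw.
    exact: indep Aw'.
  - exact/balanced_withP.
  - exact/balanced_withP.
  - by split; [apply: adjacency_eigenvalue sym_e w0 _
              |apply: adjacency_eigenvalue sym_e w'0 _].
(* A balanced [v] is deformed into itself by the constant curve; otherwise the second claim already
   provides a target. *)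
split => //; have [bal_v|/not_balanced] := pselect (balanced e v).
  exists v; split => //; exists (fun=> v); split => //.
  by apply: continuous_subspaceT => t; exact: cvg_cst.
move=> [w [_ [theta [_ [[def_w _] bal_w _ _ _]]]]].
by exists w; split => //; exists theta.
Qed.
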